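(* Let $\mathbf{A}\in\mathbb{R}^{n\times n}$ with $\rho^2(\mathbf{A})\ge 1$, let $(\mathbf{A},\mathbf{C})$ be observable and $(\mathbf{A},\sqrt{\mathbf{W}})$ controllable, and let $c(i)=\mathrm{Tr}(v^i(\bar{\mathbf{P}}_0))$, $i\in\mathbb{N}$, be the estimation-error function. Then for any $\epsilon>0$ there exist $N>0$ and $\kappa>0$ such that $$c(i)<\kappa\left(\rho^2(\mathbf{A})+\epsilon\right)^i,\qquad \forall i>N .$$
   Context: $\rho(\cdot)$ is the spectral radius. The underlying system is $\mathbf{x}_{t+1}=\mathbf{A}\mathbf{x}_t+\mathbf{w}_t$, $\mathbf{y}_t=\mathbf{C}\mathbf{x}_t+\mathbf{v}_t$, $\mathbf{x}_t\in\mathbb{R}^n$, $\mathbf{y}_t\in\mathbb{R}^m$, with independent i.i.d. zero-mean Gaussian noises of covariances $\mathbf{W}$ and $\mathbf{V}$. Observability and controllability mean that $[\mathbf{C}^\top,\mathbf{A}^\top\mathbf{C}^\top,\dots,(\mathbf{A}^n)^\top\mathbf{C}^\top]$ and $[\sqrt{\mathbf{W}},\mathbf{A}\sqrt{\mathbf{W}},\dots,\mathbf{A}^n\sqrt{\mathbf{W}}]$ have full rank. $\bar{\mathbf{P}}_0$ is the (finite, positive semidefinite) limit as $t\to\infty$ of the posterior error covariance $\mathbf{P}^s_{t|t}$ of the Kalman filter for this system: $\mathbf{P}^s_{t|t-1}=\mathbf{A}\mathbf{P}^s_{t-1|t-1}\mathbf{A}^\top+\mathbf{W}$, $\mathbf{K}_t=\mathbf{P}^s_{t|t-1}\mathbf{C}^\top(\mathbf{C}\mathbf{P}^s_{t|t-1}\mathbf{C}^\top+\mathbf{V})^{-1}$,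 $\mathbf{P}^s_{t|t}=(\mathbf{I}-\mathbf{K}_t\mathbf{C})\mathbf{P}^s_{t|t-1}$. The map $v$ is $v(\mathbf{X})=\mathbf{A}\mathbf{X}\mathbf{A}^\top+\mathbf{W}$, with $v^1=v$, $v^{m+1}=v\circ v^m$. *)

(* Defs.v *)
(* MathComp / MathComp-Analysis, with R[i] from mathcomp-real-closed. *)
From HB Require Import structures.
From mathcomp Require Export all_boot all_order all_algebra.
From mathcomp Require Export all_classical all_reals all_analysis.
From mathcomp Require Export complex.
Set Implicit Arguments.
Unset Strict Implicit.
Unset Printing Implicit Defensive.
Import Order.TTheory GRing.Theory Num.Theory.
Import numFieldNormedType.Exports.
Local Open Scope classical_set_scope.
Local Open Scope ring_scope.

(* The eigenvalues are the complex ones, and [Normc.normc] is the R-valued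
   modulus.  The set is finite, and it is empty only for n = 0, where the
   supremum is 0. *)
Definition spectral_radius (R : realType) (n : nat) (A : 'M[R]_n) : R :=
  sup [set Normc.normc z
      | z in [set z : R[i] | eigenvalue (map_mx (real_complex R) A) z]].

Definition psdmx (R : realType) (n : nat) (S : 'M[R]_n) : Prop :=
  S \is symmetricmx /\ forall x : 'cV[R]_n, 0 <= (x^T *m S *m x) 0 0.

(* [S] is the positive semidefinite square root of [W]: it exists and is unique
   whenever [W] is positive semidefinite. *)
Definition is_sqrtmx (R : realType) (n : nat) (W S : 'M[R]_n) : Prop :=
  psdmx S /\ S *m S = W.

(* In the next two definitions the exponents run over 0, ..., n inclusive, and
   full rank means rank n, the number of rows. *)
Definition observable (R : realType) (n m : nat)
    (A : 'M[R]_n) (C : 'M[R]_(m, n)) : Prop :=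
  row_free (\mxrow_(i < n.+1) ((A ^+ i)^T *m C^T)).

Definition controllable (R : realType) (n p : nat)
    (A : 'M[R]_n) (B : 'M[R]_(n, p)) : Prop :=
  row_free (\mxrow_(i < n.+1) (A ^+ i *m B)).

Definition cov_pred (R : realType) (n : nat) (A W X : 'M[R]_n) : 'M[R]_n :=
  A *m X *m A^T + W.

(* If the innovation covariance is singular, [invmx] returns it unchanged. *)
Definition kalman_gain (R : realType) (n m : nat)
    (C : 'M[R]_(m, n)) (V : 'M[R]_m) (P : 'M[R]_n) : 'M[R]_(n, m) :=
  P *m C^T *m invmx (C *m P *m C^T + V).

(* [kalman_post A C W V P0 t] is the posterior error covariance P_{t|t} of the
   filter started from P_{0|0} = P0. *)
Fixpoint kalman_post (R : realType) (n m : nat)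
    (A : 'M[R]_n) (C : 'M[R]_(m, n)) (W : 'M[R]_n) (V : 'M[R]_m)
    (P0 : 'M[R]_n) (t : nat) : 'M[R]_n :=
  if t is t'.+1 then
    let P := cov_pred A W (kalman_post A C W V P0 t') in
    (1%:M - kalman_gain C V P *m C) *m P
  else P0.

Definition err_fun (R : realType) (n : nat) (A W P : 'M[R]_n) (i : nat) : R :=
  \tr (iter i (cov_pred A W) P).

(* Main.v *)
Require Import Defs.
From mathcomp Require Import all_boot all_order all_algebra.
From mathcomp Require Import all_classical all_reals all_analysis.
From mathcomp Require Import complex.
From mathcomp Require Import lra.
Import Order.TTheory GRing.Theory Num.Theory.
Import numFieldNormedType.Exports.
Local Open Scope classical_set_scope.
Local Open Scope ring_scope.

(** Unrolling the recursion, v^i(P) = A^i P (A^i)^T + sum_(k < i) A^k W (A^k)^T,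
    so it suffices that the entries of A^k are O(r^k) with
    r^2 = rho(A)^2 + epsilon > 1; the sum is then geometric of ratio r^2.  The
    bound on A^k comes from Cayley-Hamilton: writing the characteristic
    polynomial as the product of the X - z_j and M_j for the product of the
    A - z_l with l < j, one has A^(k+1) M_j = z_j A^k M_j + A^k M_(j+1), and
    M_n = 0, so A^k M_j = O(r^k) by descending induction on j. *)

(** If K' >= K / (r - a) then a * K' + K <= K' * r, so the bound passes from i to i + 1; adding the
    absolute value of [u 0] settles the base case. *)
Lemma geometric_bound (R : realFieldType) (a r K : R) (u : nat -> R) :
  0 <= a -> a < r -> 0 <= K ->
  (forall i, u i.+1 <= a * u i + K * r ^+ i) ->
  exists2 K', 0 <= K' & forall i, u i <= K' * r ^+ i.
Proof.
move=> a0 ar K0 uS; have ra : 0 < r - a by rewrite subr_gt0.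
have r0 : 0 <= r by apply: le_trans (ltW ar).
have D0 : 0 <= K / (r - a) by rewrite divr_ge0 // ltW.
exists (`|u 0%N| + K / (r - a)) => [|i]; first exact: addr_ge0.
elim: i => [|i IH]; first by rewrite expr0 mulr1 ler_wpDr // ler_norm.
apply: le_trans (uS i) _.
apply: le_trans (lerD (ler_wpM2l a0 IH) (lexx _)) _.
rewrite mulrA -mulrDl exprS mulrA ler_wpM2r ?exprn_ge0 // [leRHS]mulrC.
rewrite -lerBrDl -mulrBl mulrDr [X in _ + X]mulrC divfK ?gt_eqF //.
by rewrite lerDr mulr_ge0 // ltW.
Qed.

(** The entrywise l^1 norm. Homogeneity, the triangle inequality and domination of each entry
    suffice below: powers are never bounded through submultiplicativity. *)
Definition sum_normc {R : realType} {p q : nat} (M : 'M[R[i]]_(p, q)) : R :=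
  \sum_i \sum_j Normc.normc (M i j).

Lemma normc_ge0 (R : realType) (z : R[i]) : 0 <= Normc.normc z.
Proof. by case: z => x y; rewrite sqrtr_ge0. Qed.

Lemma normc_le_sum (R : realType) (p q : nat) (M : 'M[R[i]]_(p, q)) i j :
  Normc.normc (M i j) <= sum_normc M.
Proof.
rewrite /sum_normc (bigD1 i) //= (bigD1 j) //= -addrA lerDl addr_ge0 //.
  by apply: sumr_ge0 => *; exact: normc_ge0.
by apply: sumr_ge0 => *; apply: sumr_ge0 => *; exact: normc_ge0.
Qed.

Lemma sum_normcD (R : realType) (p q : nat) (M N : 'M[R[i]]_(p, q)) :
  sum_normc (M + N) <= sum_normc M + sum_normc N.
Proof.
rewrite /sum_normc -big_split /=; apply: ler_sum => i _.
rewrite -big_split /=; apply: ler_sum => j _.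
by rewrite mxE; exact: le_normcD.
Qed.

Lemma sum_normcZ (R : realType) (p q : nat) z (M : 'M[R[i]]_(p, q)) :
  sum_normc (z *: M) = Normc.normc z * sum_normc M.
Proof.
rewrite /sum_normc mulr_sumr; apply: eq_bigr => i _.
by rewrite mulr_sumr; apply: eq_bigr => j _; rewrite mxE Normc.normcM.
Qed.

Lemma sum_normc0 (R : realType) (p q : nat) :
  sum_normc (0 : 'M[R[i]]_(p, q)) = 0.
Proof.
rewrite /sum_normc big1 // => i _.
by rewrite big1 // => j _; rewrite mxE Normc.normc0.
Qed.

(** The descending induction becomes an induction on [s] with [M] general: [M] absorbs the linear
    factors already taken off the polynomial. Repeated roots cost no polynomial factor in i, because
    every modulus is strictly below [r]. *)
Lemma sum_normc_exp_le (R : realType) (n q : nat) (B : 'M[R[i]]_n.+1)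
    (s : seq R[i]) (r : R) (M : 'M[R[i]]_(n.+1, q)) :
  (forall z, z \in s -> Normc.normc z < r) ->
  horner_mx B (\prod_(z <- s) ('X - z%:P)) *m M = 0 ->
  exists2 K, 0 <= K & forall i, sum_normc (B ^+ i *m M) <= K * r ^+ i.
Proof.
elim: s M => [|z s IH] M sr.
  rewrite big_nil rmorph1 mul1mx => ->.
  by exists 0 => // i; rewrite mulmx0 sum_normc0 mul0r.
have zr : Normc.normc z < r by apply: sr; rewrite mem_head.
(* Commuting the factors puts [B - z%:M] next to [M], so that the induction hypothesis applies to
   their product. *)
rewrite big_cons mulrC rmorphM rmorphB /= horner_mx_X horner_mx_C.
rewrite -[_ * _]/(_ *m _) -mulmxA => /IH[w ws|K K0 leK].
  by apply: sr; rewrite inE ws orbT.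
apply: (geometric_bound _ (Normc.normc z) r K) => // [|i]; first exact: normc_ge0.
rewrite -sum_normcZ; apply: le_trans (lerD (lexx _) (leK i)).
suff -> : B ^+ i.+1 *m M = z *: (B ^+ i *m M) + B ^+ i *m ((B - z%:M) *m M).
  exact: sum_normcD.
rewrite mulmxBl mulmxBr mul_scalar_mx -scalemxAr addrC subrK exprSr.
by rewrite mulmxA.
Qed.

Lemma spectral_radius_ge (R : realType) (n : nat) (A : 'M[R]_n) (z : R[i]) :
  eigenvalue (map_mx (real_complex R) A) z ->
  Normc.normc z <= spectral_radius A.
Proof.
move=> zA; apply: ub_le_sup; last by exists z.
have [s cE] := closed_field_poly_normal (char_poly (map_mx (real_complex R) A)).
(* The supremum dominates its members once the set is bounded above; the sum of the moduli of all
   roots is such a bound. *)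
exists (\sum_(w <- s) Normc.normc w) => _ [w /= wA <-].
move: wA; rewrite eigenvalue_root_char cE (monicP (char_poly_monic _)) scale1r.
rewrite root_prod_XsubC => ws; rewrite (big_rem w) //= lerDl.
by apply: sumr_ge0 => *; exact: normc_ge0.
Qed.

Lemma entries_exp_le (R : realType) (n : nat) (A : 'M[R]_n) (r : R) :
  spectral_radius A < r ->
  exists2 K, 0 <= K & forall k i j, `|(A ^+ k) i j| <= K * r ^+ k.
Proof.
case: n A => [|n] A Ar; first by exists 0 => // k [].
set B := map_mx (real_complex R) A.
have [s cE] := closed_field_poly_normal (char_poly B).
have cs : char_poly B = \prod_(z <- s) ('X - z%:P).
  by rewrite cE (monicP (char_poly_monic _)) scale1r.
have [z zs||K K0 leK] := sum_normc_exp_le R n n.+1 B s r 1%:M.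
- apply: le_lt_trans Ar; apply: spectral_radius_ge.
  by rewrite eigenvalue_root_char cs root_prod_XsubC.
- by rewrite -cs Cayley_Hamilton mul0mx.
exists K => // k i j; apply: le_trans (leK k).
apply: le_trans (normc_le_sum _ _ _ _ i j).
rewrite mulmx1 -rmorphXn /= mxE /=.
by rewrite expr0n addr0 sqrtr_sqr.
Qed.

(** The trace is the sum over i, j, l of M i l * X l j * M i j, where the two entries of [M]
    contribute at most [b ^+ 2]. *)
Lemma trace_congr_le (R : realDomainType) (n : nat) (M X : 'M[R]_n) (b : R) :
  (forall i j, `|M i j| <= b) ->
  \tr (M *m X *m M^T) <= (\sum_(i < n) \sum_j \sum_l `|X l j|) * b ^+ 2.
Proof.
move=> Mb; rewrite /mxtrace mulr_suml; apply: ler_sum => i _.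
rewrite mxE mulr_suml; apply: ler_sum => j _.
rewrite !mxE !mulr_suml; apply: ler_sum => l _.
apply: le_trans (ler_norm _) _; rewrite !normrM mulrAC mulrC expr2.
by apply: ler_wpM2l => //; apply: ler_pM.
Qed.

Lemma iter_cov_pred (R : realType) (n : nat) (A W P : 'M[R]_n) (i : nat) :
  iter i (cov_pred A W) P =
    A ^+ i *m P *m (A ^+ i)^T + \sum_(k < i) A ^+ k *m W *m (A ^+ k)^T.
Proof.
elim: i => [|i IH].
  by rewrite big_ord0 addr0 expr0 trmx1 mulmx1 mul1mx.
have AS k X : A *m (A ^+ k *m X *m (A ^+ k)^T) *m A^T
    = A ^+ k.+1 *m X *m (A ^+ k.+1)^T.
  by rewrite exprS -[A * _]/(A *m _) trmx_mul !mulmxA.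
rewrite iterS IH /cov_pred mulmxDr mulmxDl AS -addrA; congr (_ + _).
(* The newest [W] is the term k = 0; conjugation by [A] shifts the older terms by one. *)
rewrite big_ord_recl expr0 trmx1 mulmx1 mul1mx addrC; congr (_ + _).
rewrite mulmx_sumr mulmx_suml; apply: eq_bigr => k _; exact: AS.
Qed.

Theorem proposition1 (R : realType) (n m : nat)
    (A : 'M[R]_n) (C : 'M[R]_(m, n))
    (W sqrtW : 'M[R]_n) (V : 'M[R]_m) (P0 Pbar0 : 'M[R]_n)
    (W_cov : psdmx W) (V_cov : psdmx V) (P0_cov : psdmx P0)
    (sqrtW_def : is_sqrtmx W sqrtW)
    (Pbar0_def : kalman_post A C W V P0 t @[t --> \oo] --> Pbar0)
    (rhoA : 1 <= spectral_radius A ^+ 2)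
    (obs : observable A C) (ctrl : controllable A sqrtW)
    (epsilon : R) (epsilon_gt0 : 0 < epsilon) :
  exists (N : nat) (kappa : R), (0 < N)%N /\ 0 < kappa /\
    forall i : nat, (N < i)%N ->
      err_fun A W Pbar0 i
        < kappa * (spectral_radius A ^+ 2 + epsilon) ^+ i.
Proof.
set q := _ + epsilon.
have q1 : 1 < q by rewrite /q; lra.
have q0 : 0 < q by lra.
set r := Num.sqrt q.
have rq : r ^+ 2 = q by rewrite sqr_sqrtr // ltW.
have rho_r : spectral_radius A < r.
  apply: le_lt_trans (ler_norm _) _.
  by rewrite -sqrtr_sqr ltr_sqrt // /q ltrDl.
have [K K0 leK] := entries_exp_le R n A r rho_r.
pose c (X : 'M[R]_n) := (\sum_(i < n) \sum_j \sum_l `|X l j|) * K ^+ 2.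
have c0 X : 0 <= c X.
  by rewrite mulr_ge0 ?sqr_ge0 //; do 3!apply: sumr_ge0 => ? _.
have tr_le k X : \tr (A ^+ k *m X *m (A ^+ k)^T) <= c X * q ^+ k.
  apply: le_trans (trace_congr_le _ _ _ X _ (leK k)) _.
  by rewrite exprMn exprAC rq mulrA.
(* The partial sums obey the recurrence with a = 1, which is why [q] has to exceed 1. *)
have [|L L0 leL] := geometric_bound R 1 q (c W)
    (fun i => \sum_(k < i) \tr (A ^+ k *m W *m (A ^+ k)^T)) ler01 q1 (c0 W).
- by move=> i; rewrite big_ord_recr /= mul1r lerD2l.
(* The bound holds for every i, so any positive N serves; the summand 1 makes kappa positive and the
   inequality strict. *)
exists 1%N, (c Pbar0 + L + 1); split=> //; split=> [|i _].
  by rewrite ltr_wpDl // addr_ge0.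
rewrite /err_fun iter_cov_pred mxtraceD raddf_sum /=.
apply: le_lt_trans (lerD (tr_le _ _) (leL _)) _.
by rewrite -mulrDl ltr_pM2r ?exprn_gt0 // ltrDl.
Qed.
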